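(* Let $\ell\ge 1$ be an integer and let $\mathbb{D}=\{+1,-1\}^{\mathbb{N}}$ be equipped with the metric $\rho(x,y)=2^{-\min\{k\ge 1:\,x_k\ne y_k\}}$ (for $x\neq y$, and $\rho(x,x)=0$). For $\theta\in[-1,1]$ define $$B_\theta:=\Bigl\{x\in\mathbb{D}:\ \lim_{n\to\infty}\frac1n\sum_{k=1}^n x_kx_{2k}\cdots x_{\ell k}=\theta\Bigr\}.$$ Then for every $\theta\in[-1,1]$, $$\dim_H(B_\theta)=1-\frac1\ell+\frac1\ell\,H\Bigl(\frac{1+\theta}{2}\Bigr),$$ where $H(t)=-t\log_2 t-(1-t)\log_2(1-t)$ for $t\in[0,1]$ and $\dim_H$ denotes Hausdorff dimension with respect to $\rho$.
   Context: $\mathbb{N}$ denotes the set of positive integers, and $x=(x_1,x_2,\dots)\in\mathbb{D}$ has coordinates $x_k\in\{+1,-1\}$. The usual convention $0\log_2 0=0$ is used in the entropy function $H$. *)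

(* Defs.v *)
From HB Require Import structures.
From mathcomp Require Import all_boot all_order all_algebra.
From mathcomp Require Import all_classical all_reals all_analysis.
Set Implicit Arguments.
Unset Strict Implicit.
Unset Printing Implicit Defensive.
Import Order.TTheory GRing.Theory Num.Theory.
Import numFieldNormedType.Exports.
Local Open Scope classical_set_scope.
Local Open Scope ring_scope.

Section hausdorff_dimension.
Context {R : realType} {T : metricType R}.
Local Open Scope ereal_scope.

(* As a supremum in \bar R, this is -oo on the empty set; the empty set is
   treated separately in [diam_pow]. *)
Definition diam (U : set T) : \bar R :=
  ereal_sup [set (mdist p.1 p.2)%:E | p in U `*` U].

(* |U|^s, with the conventions |set0|^s = 0 and, for U nonempty, |U|^0 = 1
   (so that the 0-dimensional measure is the counting measure). *)
Definition diam_pow (s : R) (U : set T) : \bar R :=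
  if U == set0 then 0 else diam U `^ s.

Definition delta_cover (delta : R) (A : set T) (U : nat -> set T) :=
  A `<=` \bigcup_i U i /\ forall i, diam (U i) <= delta%:E.

Definition hausdorff_premeasure (s delta : R) (A : set T) : \bar R :=
  ereal_inf [set \sum_(0 <= i <oo) diam_pow s (U i)
            | U in [set U | delta_cover delta A U]].

Definition hausdorff_measure (s : R) (A : set T) : \bar R :=
  ereal_sup [set hausdorff_premeasure s delta A
            | delta in [set delta : R | (0 < delta)%R]].

Definition hausdorff_dim (A : set T) : \bar R :=
  ereal_inf [set s%:E | s in
    [set s : R | (0 <= s)%R /\ hausdorff_measure s A = 0]].

End hausdorff_dimension.

(* The space {+1,-1}^N, N being the positive integers. The Boolean [b] stands
   for the sign (-1)^b, and the k-th coordinate (k >= 1) is stored at index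
   k - 1. The field [R] in which the distance takes its values is a phantom
   argument, so that it can be recovered from the type. *)
Definition signseq (R : realType) : Type := nat -> bool.

HB.instance Definition _ (R : realType) :=
  Choice.copy (signseq R) (nat -> bool).

(* Only meaningful for 0 < k. *)
Definition sign_at (R : realType) (x : signseq R) (k : nat) : R :=
  (-1) ^+ (x k.-1).

Section rho.
Context {R : realType}.
Implicit Types x y z : signseq R.

Definition differ_at x y (k : nat) : bool :=
  (0 < k)%N && (sign_at x k != sign_at y k).

Definition rho x y : R :=
  if pselect (exists k, differ_at x y k) is left xy then 2 ^- (ex_minn xy)
  else 0.

Let differ_sym x y k : differ_at x y k = differ_at y x k.
Proof. by rewrite /differ_at eq_sym. Qed.

Lemma rhoxx x : rho x x = 0.
Proof.
rewrite /rho; case: pselect => // h; exfalso; case: h => k.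
by rewrite /differ_at eqxx andbF.
Qed.

Lemma rho_ge0 x y : 0 <= rho x y.
Proof. by rewrite /rho; case: pselect => // h; rewrite invr_ge0 exprn_ge0. Qed.

Lemma rho_sym x y : rho x y = rho y x.
Proof.
rewrite /rho; case: pselect => [xy|xy]; case: pselect => [yx|yx] //.
- by congr (_ ^- _); apply: eq_ex_minn => k; exact: differ_sym.
- by case: yx; case: xy => k; rewrite differ_sym; exists k.
- by case: xy; case: yx => k; rewrite differ_sym; exists k.
Qed.

Lemma rho_positivity x y : rho x y = 0 -> x = y.
Proof.
rewrite /rho; case: pselect => [xy|xy] /eqP.
  by rewrite invr_eq0 expf_eq0 pnatr_eq0 andbF.
move=> _; apply/funext => k; apply: contra_notP xy => xyk; exists k.+1.
rewrite /differ_at /sign_at /=; apply/eqP => /eqP.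
by rewrite (inj_eq signr_inj) => /eqP.
Qed.

Lemma rho_ultra y x z : rho x z <= Num.max (rho x y) (rho y z).
Proof.
rewrite {1}/rho; case: pselect => [xz|_]; last first.
  by rewrite le_max rho_ge0.
case: ex_minnP => n nxz _.
have le2 u v (uv : differ_at u v n) : 2 ^- n <= rho u v.
  rewrite /rho; case: pselect => [h|[]]; last by exists n.
  case: ex_minnP => m _ /(_ _ uv) mn.
  by rewrite lef_pV2 ?posrE ?exprn_gt0 // ler_weXn2l // ler1n.
rewrite le_max; move: nxz; rewrite /differ_at => /andP[n0 nxz].
have [xy|xy] := eqVneq (sign_at x n) (sign_at y n).
  by rewrite (le2 y z) ?orbT// /differ_at n0 -xy.
by rewrite (le2 x y) // /differ_at n0.
Qed.

Lemma rho_triangle y x z : rho x z <= rho x y + rho y z.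
Proof.
apply: le_trans (rho_ultra y x z) _.
by rewrite ge_max lerDl lerDr !rho_ge0.
Qed.

End rho.

HB.instance Definition _ (R : realType) :=
  isMetric.Build R (signseq R) rhoxx rho_positivity rho_sym rho_triangle.

Lemma mdist_signseq (R : realType) (x y : signseq R) : mdist x y = rho x y.
Proof. by []. Qed.

Definition multiple_average (R : realType) (l : nat) (x : signseq R) (n : nat)
    : R :=
  n%:R^-1 * \sum_(1 <= k < n.+1) \prod_(1 <= j < l.+1) sign_at x (j * k).

Definition level_set (R : realType) (l : nat) (theta : R)
    : set (signseq R) :=
  [set x | multiple_average l x n @[n --> \oo] --> theta].

Definition log2 (R : realType) (t : R) : R := ln t / ln 2.

(* The convention 0 log2 0 = 0 holds since [0 * _ = 0]. *)
Definition entropy (R : realType) (t : R) : R :=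
  - t * log2 t - (1 - t) * log2 (1 - t).

(* Main.v *)
Require Import Defs.
From mathcomp Require Import all_boot all_order all_algebra.
From mathcomp Require Import all_classical all_reals all_analysis.
From mathcomp Require Import ring lra zify.
Import Order.TTheory GRing.Theory Num.Theory.
Import numFieldNormedType.Exports.
Local Open Scope ring_scope.

(* Put y_k = x_k x_{2k} ... x_{lk} and p = (1 + theta) / 2. As x_{lk} occurs in
   y_k but in no y_j with j < k, the coordinates whose index is not a multiple of
   l and the y_k can be prescribed freely. Giving a word of length N, with
   n = N / l rounded down, the mass 2^-(N - n) q^c (1 - q)^(n - c), where c
   counts the k <= n with y_k = 1, thus defines a probability on the tree of
   words.

   Upper bound: for q close to p, words with c/n close to p have mass at least
   2^(-N (d + small)), so every s > d admits arbitrarily cheap covers by the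
   corresponding cylinders.

   Lower bound: for q = p the mass is multiplied by e^(kappa n) phi(c - n p) with
   phi z = max(0, A - z^2). For A large this is submean on the tree, it is
   positive only on words for which c - n p stays bounded, hence only along points
   of the level set, and it is at most a constant times 2^(-N s) for s < d. *)

(** * Products along multiples, as bits of words *)

(* [x] stores the sign -1 as [true], so the product of signs becomes a sum of
   bits: the bit is [false] iff x_k x_{2k} ... x_{lk} = 1. *)
Definition mult_bit (l : nat) (x : nat -> bool) (k : nat) : bool :=
  \big[addb/false]_(1 <= j < l.+1) x (j * k)%N.-1.

Definition plus_count (l : nat) (x : nat -> bool) (n : nat) : nat :=
  (\sum_(1 <= k < n.+1) ~~ mult_bit l x k)%N.

Lemma prod_sign_at (R : realType) (l : nat) (x : signseq R) (k : nat) :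
  \prod_(1 <= j < l.+1) sign_at x (j * k) = (-1) ^+ mult_bit l x k.
Proof.
rewrite /mult_bit (big_morph (fun b : bool => (-1 : R) ^+ b)
  (fun a b => signr_addb R a b) (erefl _)).
by apply: eq_bigr.
Qed.

Lemma multiple_averageE (R : realType) (l : nat) (x : signseq R) (n : nat) :
  multiple_average l x n = n%:R^-1 * (2 * (plus_count l x n)%:R - n%:R).
Proof.
rewrite /multiple_average /plus_count; congr (_ * _).
elim: n => [|n IH]; first by rewrite !big_geq // mulr0 subrr.
rewrite big_nat_recr//= IH [in RHS]big_nat_recr//= prod_sign_at natrD -natr1.
by case: mult_bit => /=; lra.
Qed.

Lemma plus_count_le (l : nat) (x : nat -> bool) (n : nat) :
  (plus_count l x n <= n)%N.
Proof.
rewrite /plus_count -[leqRHS](card_ord n) -sum1_card big_add1 big_mkord.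
by apply: leq_sum => i _; case: mult_bit.
Qed.

Lemma plus_countS (l : nat) (x : nat -> bool) (n : nat) :
  plus_count l x n.+1 = (~~ mult_bit l x n.+1 + plus_count l x n)%N.
Proof. by rewrite /plus_count big_nat_recr//= addnC. Qed.

Lemma eq_mult_bit (l : nat) (x y : nat -> bool) (k : nat) : (0 < k)%N ->
  (forall i, (i < l * k)%N -> x i = y i) -> mult_bit l x k = mult_bit l y k.
Proof.
move=> k0 xy; apply: eq_big_nat => j /andP[j0 jl]; apply: xy.
have : (0 < j * k)%N by rewrite muln_gt0 j0.
have : (j * k <= l * k)%N by rewrite leq_mul2r -ltnS jl orbT.
lia.
Qed.

Lemma eq_plus_count (l : nat) (x y : nat -> bool) (n : nat) :
  (forall i, (i < l * n)%N -> x i = y i) -> plus_count l x n = plus_count l y n.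
Proof.
move=> xy; apply: eq_big_nat => k /andP[k0 kn].
rewrite (@eq_mult_bit _ x y)// => i il; apply: xy; apply: leq_trans il _.
by rewrite leq_mul2l -ltnS kn orbT.
Qed.

(** Only the factor [j = l] reads the new last coordinate; the others read indices below
    [size u]. *)
Lemma mult_bit_rcons (l : nat) (u : seq bool) (b : bool) (k : nat) :
  (0 < l)%N -> (l * k = (size u).+1)%N ->
  mult_bit l (nth false (rcons u b)) k =
  b (+) mult_bit l (nth false (rcons u false)) k.
Proof.
move=> l0 lk; rewrite /mult_bit !big_nat_recr//= lk /=.
rewrite !nth_rcons ltnn eqxx addbF.
rewrite addbC; congr (_ (+) _); apply: eq_big_nat => j /andP[j0 jl].
have jk : (0 < j * k)%N by rewrite muln_gt0 j0; case: k lk => //; rewrite muln0.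
have jlk : (j * k < l * k)%N.
  by rewrite ltn_mul2r jl andbT; case: k lk {jk} => //; rewrite muln0.
by rewrite !nth_rcons (_ : (j * k).-1 < size u)%N//; lia.
Qed.

(** * Masses on the tree of binary words *)

(** Coordinates that complete no product are fair coins, whence the power of 2. The weight [g] of
    the products is a parameter because the two bounds use different ones. *)
Definition word_mass {R : realType} (l : nat) (g : nat -> nat -> R)
    (u : seq bool) : R :=
  let n := (size u %/ l)%N in
  2 ^- (size u - n) * g n (plus_count l (nth false u) n).

(* If the new coordinate has index l * n, flipping it flips the n-th product. *)
Lemma word_mass_rcons (R : realType) (l : nat) (g : nat -> nat -> R)
    (u : seq bool) : (0 < l)%N ->
  let n := (size u %/ l)%N in let c := plus_count l (nth false u) n in
  word_mass l g (rcons u false) + word_mass l g (rcons u true) =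
  if (l %| (size u).+1)%N
  then 2 ^- (size u - n) * (g n.+1 c.+1 + g n.+1 c)
  else word_mass l g u.
Proof.
move=> l0 n c; rewrite /word_mass !size_rcons divnS// -/n.
have nu : (l * n <= size u)%N by rewrite mulnC leq_divM.
have cE b : plus_count l (nth false (rcons u b)) n = c.
  apply: eq_plus_count => i il; rewrite nth_rcons.
  by rewrite (leq_trans il nu).
have nsz : (n <= size u)%N by apply: leq_div.
case: ifPn => [dv|ndv] /=; last first.
  rewrite !add0n !cE -/c subSn// exprS invfM; field.
  by rewrite expf_neq0.
rewrite !add1n subSS -mulrDr; congr (_ * _); rewrite !plus_countS !cE.
have lnS : (l * n.+1 = (size u).+1)%N.
  by rewrite -[RHS](divnK dv) divnS// dv mulnC.
rewrite (mult_bit_rcons _ _ true)//=.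
by case: mult_bit => /=; rewrite ?add1n ?add0n ?addn0// addrC.
Qed.

Lemma prefix_split (u w : seq bool) :
  prefix u w = [|| w == u, prefix (rcons u false) w | prefix (rcons u true) w].
Proof.
elim: u w => [|a u IH] [|b w] //=.
  by rewrite !prefix0s; case: b.
by rewrite IH eqseq_cons (eq_sym b); case: eqP => //= _; rewrite andbF.
Qed.

Lemma prefix_rcons_excl (u w : seq bool) :
  prefix (rcons u false) w && prefix (rcons u true) w = false.
Proof.
elim: u w => [|a u IH] [|b w] //=; first by rewrite !prefix0s !andbT; case: b.
by rewrite andbACA IH andbF.
Qed.

Lemma prefix_rcons_self (u : seq bool) (b : bool) : prefix (rcons u b) u = false.
Proof. by apply/negP => /size_prefix; rewrite size_rcons ltnn. Qed.

(** Distinct words of a given length have total mass at most [P [::]], so summing over lengths gives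
    a geometric series. *)
Lemma geometric_word_sum (R : realFieldType) (P : seq bool -> R) (r : R)
    (s : seq (seq bool)) :
  (forall u, 0 <= P u) ->
  (forall u, P (rcons u false) + P (rcons u true) <= P u) ->
  0 < r < 1 -> uniq s ->
  \sum_(w <- s) P w * r ^+ size w <= P [::] / (1 - r).
Proof.
move=> P0 PD /andP[r0 r1] us.
(* [k] bounds the height of [s] above [u]; for [k = 0] no word of [s] extends [u]. *)
have key k u : (forall w, w \in s -> size w < size u + k)%N ->
    \sum_(w <- s | prefix u w) P w * r ^+ size w <= P u * r ^+ size u / (1 - r).
  elim: k u => [|k IH] u hs.
    rewrite big_seq_cond big_pred0 => [|w]; last first.
      apply/negP => /andP[/hs]; rewrite addn0 => wu /size_prefix.
      by rewrite leqNgt wu.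
    by rewrite divr_ge0 ?mulr_ge0 ?exprn_ge0 ?subr_ge0 ?P0 ?(ltW r0) ?(ltW r1).
  have hsb b w : w \in s -> (size w < size (rcons u b) + k)%N.
    by move/hs; rewrite size_rcons addSnnS.
  have -> : \sum_(w <- s | prefix u w) P w * r ^+ size w =
      \sum_(w <- s | w == u) P w * r ^+ size w +
      (\sum_(w <- s | prefix (rcons u false) w) P w * r ^+ size w +
       \sum_(w <- s | prefix (rcons u true) w) P w * r ^+ size w).
    rewrite [LHS]big_mkcond [X in X + _]big_mkcond [X in _ + (X + _)]big_mkcond.
    rewrite [X in _ + (_ + X)]big_mkcond -!big_split; apply: eq_bigr => w _ /=.
    rewrite prefix_split; case: eqP => [->|_].
      by rewrite !prefix_rcons_self !addr0.
    by have := prefix_rcons_excl u w; do 2 case: prefix => //=; rewrite !(add0r,addr0).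
  have first_le : \sum_(w <- s | w == u) P w * r ^+ size w <= P u * r ^+ size u.
    rewrite -big_filter; have [us'|us'] := boolP (u \in s).
      by rewrite (filter_pred1_uniq us us') big_seq1.
    rewrite big1_seq => [|w]; first by rewrite mulr_ge0 ?exprn_ge0 ?P0 ?(ltW r0).
    by rewrite mem_filter => /andP[_ /andP[/eqP -> ws]]; rewrite ws in us'.
  (* As [1 / (1 - r) = 1 + r / (1 - r)], the first term pays for [u] and the second for the subtrees
     of its children. *)
  have := IH _ (hsb false); have := IH _ (hsb true).
  rewrite !size_rcons exprS.
  set A := \sum_(w <- s | w == u) _ in first_le *; set B := \sum_(w <- s | _) _.
  set C := \sum_(w <- s | _) _ => hC hB.
  have := PD u; have d0 : 0 < 1 - r by rewrite subr_gt0.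
  have e0 : 0 <= r ^+ size u by rewrite exprn_ge0 // ltW.
  rewrite ler_pdivlMr //; rewrite !ler_pdivlMr // in hB hC.
  move: e0 first_le hB hC; set e := r ^+ _ => e0 hA hB hC hP.
  have := ler_wpM2r (mulr_ge0 (ltW r0) e0) hP.
  have := ler_wpM2r (ltW d0) hA.
  lra.
rewrite (eq_bigl (prefix [::])) => [|w]; last by rewrite prefix0s.
have := key (\sum_(w <- s) size w).+1 [::]; rewrite expr0 mulr1 add0n.
apply => w ws.
by rewrite ltnS (big_rem w)//= leq_addr.
Qed.

(* A mass that is subadditive along the tree of words plays the role of a
   Frostman measure: the branch is built greedily, always entering a child whose
   mass exceeds the total mass of the remaining words [w i] below it. *)
Lemma avoiding_branch (R : realType) (P : seq bool -> R) (w : nat -> seq bool) :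
  (forall u, 0 <= P u) ->
  (forall u, P u <= P (rcons u false) + P (rcons u true)) ->
  (\sum_(0 <= i <oo) (P (w i))%:E < (P [::])%:E)%E ->
  exists x : nat -> bool, forall N,
    0 < P (mkseq x N) /\ forall i, w i <> mkseq x N.
Proof.
move=> P0 PD hroot.
pose t u i : \bar R := if prefix u (w i) then (P (w i))%:E else 0%E.
have t0 u i : (0 <= t u i)%E by rewrite /t; case: ifP; rewrite ?lee_fin.
pose S u := (\sum_(0 <= i <oo) t u i)%E.
(* [S u] is the mass of the listed words extending [u]. A light word is none of the [w i], since its
   own mass would then be a term of [S u]. *)
pose light u := (S u < (P u)%:E)%E.
have S0 u : (0 <= S u)%E by apply: nneseries_ge0.
have lightP u : light u -> 0 < P u /\ forall i, w i <> u.
  move=> lu; split; first by rewrite -lte_fin; exact: le_lt_trans lu.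
  move=> i wi; move: lu; rewrite /light ltNge => /negP; apply.
  apply: (@le_trans _ _ (t u i)); first by rewrite /t wi prefix_refl.
  apply: le_trans (nneseries_lim_ge (m := 0) i.+1 _) => //.
  by rewrite big_nat_recr//= leeDr// sume_ge0.
have light_child u : light u -> exists b, light (rcons u b).
  move=> lu; have [_ wu] := lightP _ lu.
  apply: contrapT => /forallNP hb.
  have h b : ((P (rcons u b))%:E <= S (rcons u b))%E.
    by rewrite leNgt; apply/negP/hb.
  move: lu; rewrite /light ltNge => /negP; apply.
  (* As [u] is not listed itself, each listed word below it extends exactly one child. *)
  apply: (@le_trans _ _ (S (rcons u false) + S (rcons u true))%E).
    by apply: le_trans (leeD (h _) (h _)); rewrite -EFinD lee_fin.
  rewrite /S -nneseriesD//; apply: lee_nneseries => [i _ _|i _].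
    by rewrite adde_ge0.
  rewrite /t (prefix_split u); case: eqP => [/wu//|_] /=.
  have := prefix_rcons_excl u (w i); do 2 case: prefix => //=;
    by rewrite ?(add0e, adde0).
have lroot : light [::].
  rewrite /light; apply: le_lt_trans hroot.
  by apply: lee_nneseries => [i _ _|i _] //; rewrite /t prefix0s.
pose nxt (u : {u | light u}) : {u | light u} :=
  let c := cid (light_child _ (proj2_sig u)) in
  exist _ (rcons (proj1_sig u) (proj1_sig c)) (proj2_sig c).
pose v n := proj1_sig (iter n nxt (exist _ [::] lroot)).
have vS n : exists b, v n.+1 = rcons (v n) b by eexists; rewrite /v iterS.
have sv n : size (v n) = n.
  by elim: n => // n IH; have [b ->] := vS n; rewrite size_rcons IH.
pose x n := nth false (v n.+1) n.
have vx n : v n = mkseq x n.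
  elim: n => [//|n IH]; have [b vb] := vS n.
  rewrite mkseqS -IH /x vb; congr rcons.
  by rewrite nth_rcons sv ltnn eqxx.
exists x => N; rewrite -vx; apply: lightP.
exact (proj2_sig (iter N nxt (exist _ [::] lroot))).
Qed.

(** * A parabola along a centred random walk *)

(* [p] and [1 - p] are the probabilities of the steps [1 - p] and [- p], which
   have mean 0. Away from the edge of the support the parabola only loses the
   variance of a step, a small fraction of its height there; close to the edge
   an inward step alone gives enough. *)
Lemma parabola_subsolution (R : realType) (p lambda : R) :
  0 <= p <= 1 -> lambda < 1 ->
  exists2 A : R, 0 < A & forall z, lambda * Num.max 0 (A - z ^+ 2) <=
    p * Num.max 0 (A - (z + (1 - p)) ^+ 2) +
    (1 - p) * Num.max 0 (A - (z - p) ^+ 2).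
Proof.
move=> /andP[p0 p1] l1.
have m0 (x : R) : 0 <= Num.max 0 x by rewrite le_max lexx.
have mge (x : R) : x <= Num.max 0 x by rewrite le_max lexx orbT.
have [->|pn0] := eqVneq p 0.
  exists 1 => // z; rewrite mul0r add0r !subr0 mul1r.
  by have := m0 (1 - z ^+ 2); set t := Num.max _ _; nra.
have [->|pn1] := eqVneq p 1.
  exists 1 => // z; rewrite subrr mul0r !addr0 mul1r.
  by have := m0 (1 - z ^+ 2); set t := Num.max _ _; nra.
have {}p0 : 0 < p by rewrite lt_neqAle eq_sym pn0.
have {}p1 : p < 1 by rewrite lt_neqAle pn1.
pose q := 1 - p; have q0 : 0 < q by rewrite subr_gt0.
have d0 : 0 < 1 - lambda by rewrite subr_gt0.
(* At heights [K] and above, the variance [p * q] of a step is at most the fraction [1 - lambda] of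
   the height. *)
pose K := p * q / (1 - lambda).
have K0 : 0 < K by rewrite divr_gt0 ?mulr_gt0.
have KE : K * (1 - lambda) = p * q by rewrite /K divfK ?gt_eqF.
(* Beyond [Z1] on the right or [Z2] on the left, the inward step, weighted by its probability, gains
   at least [K]. *)
pose Z1 := (K / q + p ^+ 2) / (2 * p); pose Z2 := (K / p + q ^+ 2) / (2 * q).
have Z10 : 0 < Z1 by rewrite /Z1 divr_gt0 ?addr_gt0 ?mulr_gt0 ?invr_gt0 ?exprn_gt0.
have Z20 : 0 < Z2 by rewrite /Z2 divr_gt0 ?addr_gt0 ?mulr_gt0 ?invr_gt0 ?exprn_gt0.
have Z1E : q * (2 * Z1 * p - p ^+ 2) = K.
  by rewrite /Z1; field; rewrite ?gt_eqF.
have Z2E : p * (2 * Z2 * q - q ^+ 2) = K.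
  by rewrite /Z2; field; rewrite ?gt_eqF.
clearbody K Z1 Z2.
(* With this [A], a height below [K] forces [z] beyond [Z1] or [- Z2]. *)
exists (K + Z1 ^+ 2 + Z2 ^+ 2) => [|z].
  by rewrite ?addr_gt0 ?exprn_gt0.
set A := K + _ + _; rewrite -/q.
have rhs0 : 0 <= p * Num.max 0 (A - (z + q) ^+ 2) + q * Num.max 0 (A - (z - p) ^+ 2).
  by apply: addr_ge0; apply: mulr_ge0; rewrite ?m0 ?(ltW p0) ?(ltW q0).
have [l0|l0] := leP lambda 0.
  by apply: le_trans rhs0; rewrite mulr_le0_ge0.
have [az|az] := leP (A - z ^+ 2) 0; first by rewrite mulr0.
have up := ler_wpM2l (ltW p0) (mge (A - (z + q) ^+ 2)).
have uq := ler_wpM2l (ltW q0) (mge (A - (z - p) ^+ 2)).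
have up0 := mulr_ge0 (ltW p0) (m0 (A - (z + q) ^+ 2)).
have uq0 := mulr_ge0 (ltW q0) (m0 (A - (z - p) ^+ 2)).
move: up uq up0 uq0; set X := _ * Num.max _ _; set Y := _ * Num.max _ _.
move=> up uq up0 uq0.
pose a := A - z ^+ 2.
have XE : p * (a - 2 * z * q - q ^+ 2) <= X by rewrite /a; lra.
have YE : q * (a + 2 * z * p - p ^+ 2) <= Y by rewrite /a; lra.
have qE : q = 1 - p by [].
rewrite -/a in az *.
have [Ka|aK] := leP K a.
  have : p * q <= a * (1 - lambda) by rewrite -KE ler_wpM2r // ltW.
  have : p * (a - 2 * z * q - q ^+ 2) + q * (a + 2 * z * p - p ^+ 2) = a - p * q.
    by rewrite qE; ring.
  nra.
have la : lambda * a <= K.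
  by apply: le_trans (ltW aK); rewrite ler_piMl // ltW.
have zz : Z1 ^+ 2 + Z2 ^+ 2 < z ^+ 2 by rewrite /a /A in aK; lra.
have [z0|z0] := leP 0 z.
  have Zz : Z1 < z.
    rewrite -(ltr_pXn2r (n := 2)) ?nnegrE ?(ltW Z10) //.
    by apply: le_lt_trans zz; rewrite lerDl exprn_ge0 ?ltW.
  have h1 : K <= q * (2 * z * p - p ^+ 2).
    by rewrite -Z1E ler_wpM2l ?(ltW q0)// lerB// ler_wpM2r ?(ltW p0)// ler_wpM2l// ltW.
  have := mulr_gt0 q0 az; lra.
have Zz : Z2 < - z.
  rewrite -(ltr_pXn2r (n := 2)) ?nnegrE ?(ltW Z20) ?oppr_ge0 ?(ltW z0)// sqrrN.
  by apply: le_lt_trans zz; rewrite lerDr exprn_ge0 ?ltW.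
have h1 : K <= p * (2 * (- z) * q - q ^+ 2).
  by rewrite -Z2E ler_wpM2l ?(ltW p0)// lerB// ler_wpM2r ?(ltW q0)// ler_wpM2l// ltW.
have := mulr_gt0 p0 az; lra.
Qed.

(** * Entropy estimates for binomial weights *)

Definition nat_entropy {R : realType} (p : R) : R :=
  - (p * ln p + (1 - p) * ln (1 - p)).

(** Writing [c] as [n * p] plus a deviation separates the cross entropy of [p] and [q] from an error
    linear in the deviation. *)
Lemma binomial_weightE (R : realType) (p q : R) (n c : nat) :
  0 < q < 1 -> (c <= n)%N ->
  q ^+ c * (1 - q) ^+ (n - c) =
  expR (n%:R * (p * ln q + (1 - p) * ln (1 - q)) +
        (c%:R - n%:R * p) * (ln q - ln (1 - q))).
Proof.
move=> /andP[q0 q1] cn; have r0 : 0 < 1 - q by rewrite subr_gt0.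
rewrite -[q ^+ c]lnK ?posrE ?exprn_gt0// -[(1 - q) ^+ _]lnK ?posrE ?exprn_gt0//.
rewrite -expRD !lnXn// -[ln q *+ _]mulr_natr -[ln (1 - q) *+ _]mulr_natr natrB//.
by congr expR; ring.
Qed.

Lemma binomial_weight_le (R : realType) (p B : R) : 0 <= p <= 1 ->
  exists2 K : R, 0 < K & forall n c, (c <= n)%N -> `|c%:R - n%:R * p| <= B ->
    p ^+ c * (1 - p) ^+ (n - c) <= K * expR (- (n%:R * nat_entropy p)).
Proof.
move=> /andP[p0 p1].
(* At the endpoints [binomial_weightE] does not apply, but the entropy is 0 and the weight at most
   1. *)
have [pe|pn] := boolP ((p == 0) || (p == 1)).
  exists 1 => // n c _ _; rewrite mul1r.
  have -> : nat_entropy p = 0.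
    by case/orP: pe => /eqP ->; rewrite /nat_entropy ?subrr ?subr0 ln1; ring.
  rewrite mulr0 oppr0 expR0 mulr_ile1 ?exprn_ge0 ?exprn_ile1 ?subr_ge0//.
  by rewrite gerBl.
have {pn}/andP[pn0 pn1] : (p != 0) && (p != 1) by rewrite -negb_or.
exists (expR (B * `|ln p - ln (1 - p)|)) => [|n c cn cB]; first exact: expR_gt0.
rewrite (@binomial_weightE _ p) ?lt_neqAle 1?eq_sym ?pn0 ?pn1 ?p0//.
rewrite -expRD ler_expR /nat_entropy mulrN opprK addrC lerD2r.
by apply: le_trans (ler_norm _) _; rewrite normrM ler_wpM2r.
Qed.

(** Inside the interval [q = p] works. At an endpoint [q] is moved inside, at the cost of exactly
    [eta]. *)
Lemma cross_entropy_approx (R : realType) (p eta : R) :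
  0 <= p <= 1 -> 0 < eta ->
  exists2 q : R, 0 < q < 1 &
    - (p * ln q + (1 - p) * ln (1 - q)) <= nat_entropy p + eta.
Proof.
move=> /andP[p0 p1] eta0; rewrite /nat_entropy.
have e1 : 0 < expR (- eta) < 1 by rewrite expR_gt0 expR_lt1 oppr_lt0.
have [->|pn0] := eqVneq p 0.
  exists (1 - expR (- eta)); first by lra.
  by rewrite subr0 (_ : 1 - (1 - _) = expR (- eta)) ?expRK ?ln1; lra.
have [->|pn1] := eqVneq p 1.
  by exists (expR (- eta)) => //; rewrite subrr expRK ln1; lra.
exists p; last by rewrite lerDl ltW.
by rewrite !lt_neqAle eq_sym pn0 pn1 p0 p1.
Qed.

(** * The masses for the lower and the upper bound *)

Lemma two_expR (R : realType) (n : nat) :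
  2 ^- n = expR (- (n%:R * ln 2)) :> R.
Proof. by rewrite expRN expRM_natl lnK// posrE. Qed.

Definition plus_deviation {R : realType} (l : nat) (p : R) (u : seq bool) : R :=
  let n := (size u %/ l)%N in (plus_count l (nth false u) n)%:R - n%:R * p.

(** This is the mass of the lower bound; the upper limit for [sigma] is [ln 2] times the claimed
    dimension. *)
Lemma subexponential_flow (R : realType) (l : nat) (p sigma : R) :
  (0 < l)%N -> 0 <= p <= 1 -> sigma < ln 2 - (ln 2 - nat_entropy p) / l%:R ->
  exists P : seq bool -> R, exists A : R, exists C : R,
  [/\ forall u, 0 <= P u,
      forall u, P u <= P (rcons u false) + P (rcons u true),
      0 < P [::],
      forall u, 0 < P u -> plus_deviation l p u ^+ 2 <= A &
      forall u, P u <= C * expR (- (sigma * (size u)%:R))].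
Proof.
move=> l0 p01 sig; have /andP[p0 p1] := p01.
set h := nat_entropy p in sig *.
(* The whole slack goes into the growth factor [expR (n%:R * kappa)], which offsets the factor
   [expR (- kappa)] lost in [parabola_subsolution]. *)
pose kappa := ln 2 - (ln 2 - h) / l%:R - sigma.
have k0 : 0 < kappa by rewrite subr_gt0.
have [|A A0 phiP] := @parabola_subsolution R p (expR (- kappa)) p01.
  by rewrite expR_lt1 oppr_lt0.
pose phi z := Num.max 0 (A - z ^+ 2).
have phi0 z : 0 <= phi z by rewrite /phi le_max lexx.
have phiA z : phi z <= A by rewrite /phi ge_max ltW//= lerBlDr lerDl sqr_ge0.
pose g n c := p ^+ c * (1 - p) ^+ (n - c) * expR (n%:R * kappa) *
  phi (c%:R - n%:R * p).
have q0 : 0 <= 1 - p by rewrite subr_ge0.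
have g0 n c : 0 <= g n c by rewrite /g !mulr_ge0 ?exprn_ge0// expR_ge0.
have gS n c : (c <= n)%N -> g n c <= g n.+1 c.+1 + g n.+1 c.
  move=> cn; rewrite /g subSS subSn// !exprS -!natr1.
  have -> : c%:R + 1 - (n%:R + 1) * p = c%:R - n%:R * p + (1 - p) by ring.
  have -> : c%:R - (n%:R + 1) * p = c%:R - n%:R * p - p by ring.
  set z := c%:R - n%:R * p; have := phiP z.
  rewrite -/(phi _) -/(phi (z + _)) -/(phi (z - _)) => hz.
  rewrite mulrDl mul1r expRD.
  pose W := p ^+ c * (1 - p) ^+ (n - c) * expR (n%:R * kappa).
  have W0 : 0 <= W by rewrite !mulr_ge0 ?exprn_ge0// expR_ge0.
  have := ler_wpM2l (mulr_ge0 W0 (expR_ge0 kappa)) hz.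
  have -> : W * expR kappa * (expR (- kappa) * phi z) = W * phi z.
    by rewrite mulrA -[W * _ * _]mulrA -expRD subrr expR0 mulr1.
  rewrite /W => hW; apply: le_trans hW _.
  by rewrite le_eqVlt; apply/orP; left; apply/eqP; ring.
have nneg u : 0 <= word_mass l g u.
  by rewrite mulr_ge0 // invr_ge0 exprn_ge0.
(* This bounds [t] whenever [t ^+ 2 <= A], since [2 * t <= 1 + t ^+ 2]; no square root is taken. *)
pose B := 1 + A.
have [K K0 hK] := @binomial_weight_le R p B p01.
(* [K] comes from the binomial weight, [A] bounds [phi], and the last factor pays for rounding
   [size u / l] down. *)
exists (word_mass l g), A, (K * A * expR `|ln 2 - h|); split => // [u||u|u].
- rewrite word_mass_rcons//; case: ifP => // _; rewrite /word_mass.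
  by rewrite ler_wpM2l ?invr_ge0 ?exprn_ge0// gS// plus_count_le.
- rewrite /word_mass /= div0n /plus_count big_geq// /g /phi /=.
  by rewrite !mul0r expR0 !expr0 invr1 !mul1r subrr expr0n/= subr0 lt_max A0 orbT.
- rewrite /word_mass /g -/(plus_deviation l p u) => hu.
  rewrite leNgt; apply/negP => hA; move: hu.
  by rewrite /phi max_l ?mulr0 ?ltxx// subr_le0 ltW.
rewrite /word_mass /g -/(plus_deviation l p u).
set n := (size u %/ l)%N; set c := plus_count _ _ _; set N := size u.
have [dA|Ad] := leP (plus_deviation l p u ^+ 2) A; last first.
  rewrite /phi max_l ?subr_le0 ?(ltW Ad)// !mulr0.
  by rewrite !mulr_ge0 ?expR_ge0// ltW.
have dB : `|c%:R - n%:R * p| <= B.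
  rewrite -/(plus_deviation l p u) /B.
  have := sqr_ge0 (1 - `|plus_deviation l p u|).
  move: dA; rewrite -(real_normK (num_real _)); set t := `|_|.
  have : 0 <= t by rewrite normr_ge0.
  nra.
have cn : (c <= n)%N by apply: plus_count_le.
have hb := hK _ _ cn dB.
rewrite two_expR natrB ?leq_div//.
apply: (@le_trans _ _ (expR (- ((N%:R - n%:R) * ln 2)) *
   (K * expR (- (n%:R * h)) * expR (n%:R * kappa) * A))).
  rewrite ler_wpM2l ?expR_ge0//; apply: ler_pM => //.
    by rewrite !mulr_ge0 ?exprn_ge0 ?expR_ge0.
  by rewrite ler_wpM2r ?expR_ge0.
rewrite [leLHS](_ : _ = K * A * (expR (- ((N%:R - n%:R) * ln 2)) *
   expR (- (n%:R * h)) * expR (n%:R * kappa))); last by ring.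
rewrite -!mulrA ler_pM2l// ler_pM2l// -!expRD ler_expR.
have lR : 0 < l%:R :> R by rewrite ltr0n.
have NE : N%:R = n%:R * l%:R + (N %% l)%:R :> R by rewrite {1}(divn_eq N l) natrD natrM.
set r := (N %% l)%:R in NE.
have r0 : 0 <= r by [].
have rl : r <= l%:R by rewrite ler_nat ltnW// ltn_mod.
pose x := N%:R / l%:R - n%:R : R.
have xE : x = r / l%:R by rewrite /x NE; field; rewrite gt_eqF.
have x0 : 0 <= x by rewrite xE divr_ge0 // ltW.
have x1 : x <= 1 by rewrite xE ler_pdivrMr// mul1r.
have h1 : - `|ln 2 - h| <= x * (ln 2 - h).
  have := ler_norm (- (ln 2 - h)); rewrite normrN.
  have := normr_ge0 (ln 2 - h); set t := `|_|; nra.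
have h2 : n%:R * kappa <= N%:R * kappa.
  by rewrite ler_wpM2r ?(ltW k0)// ler_nat leq_div.
have -> : - (sigma * N%:R) = N%:R * kappa - N%:R * ln 2 + (x + n%:R) * (ln 2 - h).
  by rewrite /kappa /x; field; rewrite gt_eqF.
lra.
Qed.

(** The mass is binomial with a parameter [q] near [p]. The slack [kappa] later makes the sum over
    words of all lengths converge. *)
Lemma cover_weight (R : realType) (l : nat) (p sigma : R) :
  (0 < l)%N -> 0 <= p <= 1 -> ln 2 - (ln 2 - nat_entropy p) / l%:R < sigma ->
  exists P : seq bool -> R, exists epsilon : R, exists kappa : R,
  [/\ 0 < epsilon, 0 < kappa, forall u, 0 <= P u,
      forall u, P (rcons u false) + P (rcons u true) <= P u &
      forall u, (l %| size u)%N ->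
        `|plus_deviation l p u| <= epsilon * (size u %/ l)%:R ->
        expR (- (sigma * (size u)%:R)) <= P u * expR (- (kappa * (size u)%:R))].
Proof.
move=> l0 p01 sig; set h := nat_entropy p in sig *.
have lR : 0 < l%:R :> R by rewrite ltr0n.
(* This is [l] times the excess of [sigma] over [ln 2] times the claimed dimension. A third each
   pays for [q], for the deviation and for [kappa]. *)
pose gap := sigma * l%:R - (l%:R - 1) * ln 2 - h.
have gap0 : 0 < gap.
  move: sig; rewrite -(ltr_pM2r lR) mulrBl divfK ?gt_eqF// /gap; lra.
have g30 : 0 < gap / 3 by rewrite divr_gt0.
have [q q01 hq] := @cross_entropy_approx R p _ p01 g30.
have /andP[q0 q1] := q01.
pose D := `|ln q - ln (1 - q)|.
have D1 : 0 < D + 1 by rewrite ltr_wpDl // normr_ge0.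
pose kappa := gap / (3 * l%:R).
have kE : kappa * l%:R = gap / 3 by rewrite /kappa; field; rewrite gt_eqF.
have k0 : 0 < kappa by rewrite divr_gt0 ?mulr_gt0.
(* [D] itself vanishes for [q = 1 / 2], hence [D + 1]. *)
pose eps := gap / (3 * (D + 1)).
have eps0 : 0 < eps by rewrite divr_gt0 ?mulr_gt0.
have eE : eps * (D + 1) = gap / 3 by rewrite /eps; field; rewrite gt_eqF.
pose g n c := q ^+ c * (1 - q) ^+ (n - c).
have r0 : 0 < 1 - q by rewrite subr_gt0.
exists (word_mass l g), eps, kappa; split => // [u|u|].
- by rewrite !mulr_ge0 ?invr_ge0 ?exprn_ge0// ltW.
- rewrite word_mass_rcons//; case: ifP => // _; rewrite /word_mass.
  rewrite ler_wpM2l ?invr_ge0 ?exprn_ge0// /g subSS subSn ?plus_count_le// !exprS.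
  by rewrite le_eqVlt; apply/orP; left; apply/eqP; ring.
move=> u /divnK lu; rewrite /word_mass /plus_deviation.
set n := (size u %/ l)%N in lu *; set c := plus_count _ _ _ => hc.
rewrite /g (@binomial_weightE _ p)// ?plus_count_le// two_expR natrB ?leq_div//.
rewrite -!expRD ler_expR -lu natrM.
have n0 : 0 <= n%:R :> R by [].
have h1 : - (n%:R * (gap / 3)) <= (c%:R - n%:R * p) * (ln q - ln (1 - q)).
  apply: (@le_trans _ _ (- `|(c%:R - n%:R * p) * (ln q - ln (1 - q))|)).
    rewrite lerN2 normrM -eE mulrA [_ * eps]mulrC.
    apply: ler_pM => //; rewrite -/D.
    by rewrite lerDl.
  by rewrite -lerNl; apply: le_trans (ler_norm _) _; rewrite normrN.
have h2 := ler_wpM2l n0 hq; rewrite mulrN -/h in h2.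
have h3 : n%:R * (kappa * l%:R) = n%:R * (gap / 3) by rewrite kE.
have h4 : n%:R * gap = n%:R * (sigma * l%:R) - n%:R * ((l%:R - 1) * ln 2) - n%:R * h.
  by rewrite /gap; ring.
lra.
Qed.

(** * The metric, cylinders and criteria for the Hausdorff measure *)

Lemma expR_eventually_small (R : realType) (C a e : R) : 0 < a -> 0 < e ->
  exists M, forall N, (M <= N)%N -> C * expR (- (a * N%:R)) < e.
Proof.
move=> a0 e0.
have ce0 : 0 <= `|C| / e / a by rewrite !divr_ge0 // ltW.
exists (Num.Def.archi_bound (`|C| / e / a)) => N hN.
have {}hN : `|C| / e / a < N%:R.
  by apply: lt_le_trans (archi_boundP ce0) _; rewrite ler_nat.
rewrite !ltr_pdivrMr// in hN.
rewrite expRN ltr_pdivrMr ?expR_gt0//.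
apply: le_lt_trans (ler_norm C) _; apply: lt_le_trans hN _.
rewrite [leLHS]mulrC ler_wpM2l ?(ltW e0)// mulrC.
apply: le_trans (expR_ge1Dx _).
by rewrite lerDr.
Qed.

Lemma ln2_gt0 (R : realType) : 0 < ln 2 :> R.
Proof. by rewrite ln_gt0 // ltr1n. Qed.

Lemma rho_le (R : realType) (x y : signseq R) (N : nat) :
  (forall i, (i < N)%N -> x i = y i) -> rho x y <= 2 ^- N.
Proof.
move=> xy; rewrite /rho; case: pselect => [h|_]; last by rewrite invr_ge0 exprn_ge0.
case: ex_minnP => -[|m]; rewrite /differ_at //= => xym _.
rewrite lef_pV2 ?posrE ?exprn_gt0// ler_weXn2l ?ler1n// leqW//.
by rewrite leqNgt; apply/negP => /xy xyE; rewrite /sign_at /= xyE eqxx in xym.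
Qed.

(** Index [N] holds coordinate [N.+1], whence the exponent. *)
Lemma rho_ge (R : realType) (x y : signseq R) (N : nat) :
  x N <> y N -> 2 ^- N.+1 <= rho x y.
Proof.
move=> xyN; have dN : differ_at x y N.+1.
  by rewrite /differ_at /sign_at /= (inj_eq signr_inj); apply/eqP.
rewrite /rho; case: pselect => [h|[]]; last by exists N.+1.
case: ex_minnP => m _ /(_ _ dN) mN.
by rewrite lef_pV2 ?posrE ?exprn_gt0// ler_weXn2l ?ler1n.
Qed.

Section ereal.
Local Open Scope ereal_scope.
Local Open Scope classical_set_scope.

Lemma diam_pow_ge0 (R : realType) (T : metricType R) (s : R) (U : set T) :
  0 <= diam_pow s U.
Proof. by rewrite /diam_pow; case: ifP => // _; exact: poweR_ge0. Qed.

Lemma poweR_two (R : realType) (s : R) (N : nat) :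
  (2 ^- N)%R%:E `^ s = (expR (- (s * ln 2 * N%:R)))%:E.
Proof.
rewrite poweR_EFin two_expR -expRM; congr (expR _)%:E.
by ring.
Qed.

Lemma diam_pow_ge (R : realType) (s : R) (U : set (signseq R)) x y (N : nat) :
  (0 <= s)%R -> U x -> U y -> x N <> y N ->
  (expR (- (s * ln 2 * N.+1%:R)))%:E <= diam_pow s U.
Proof.
move=> s0 Ux Uy xy; rewrite /diam_pow; case: eqP => [U0|_].
  by rewrite U0 in Ux.
have le2 : (2 ^- N.+1)%R%:E <= diam U.
  apply: (@le_trans _ _ (mdist x y)%:E).
    by rewrite lee_fin mdist_signseq rho_ge.
  by apply: ereal_sup_ubound; exists (x, y).
rewrite -poweR_two; apply: gt0_ler_poweR => //.
  by rewrite in_itv/= leey lee_fin invr_ge0 exprn_ge0.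
rewrite in_itv/= leey andbT; apply: le_trans le2.
by rewrite lee_fin invr_ge0 exprn_ge0.
Qed.

Definition cylinder (R : realType) (w : seq bool) : set (signseq R) :=
  [set x | mkseq x (size w) = w].

Lemma diam_cylinder (R : realType) (w : seq bool) :
  diam (cylinder R w) <= (2 ^- size w)%R%:E.
Proof.
apply: ge_ereal_sup => _ [[x y] [/= xw yw] <-].
rewrite lee_fin mdist_signseq rho_le// => i iw.
by rewrite -(nth_mkseq false x iw) -(nth_mkseq false y iw) xw yw.
Qed.

Lemma diam_pow_cylinder (R : realType) (s : R) (w : seq bool) : (0 <= s)%R ->
  diam_pow s (cylinder R w) <= (expR (- (s * ln 2 * (size w)%:R)))%:E.
Proof.
move=> s0; rewrite /diam_pow; case: eqP => [_|_].
  by rewrite lee_fin expR_ge0.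
have w0 : cylinder R w (nth false w) by apply: mkseq_nth.
rewrite -poweR_two; apply: gt0_ler_poweR => //; last exact: diam_cylinder.
  rewrite in_itv/= leey andbT; apply: ereal_sup_ubound.
  exists (nth false w : signseq R, nth false w : signseq R) => //=.
  by rewrite mdist_signseq rhoxx.
by rewrite in_itv/= leey lee_fin invr_ge0 exprn_ge0.
Qed.

(** The cylinders of all good words of length at least [M] cover [A]. Half of the decay [kappa]
    makes the sum of their costs converge, the other half makes it small as [M] grows. *)
Lemma hausdorff_measure_eq0 (R : realType) (s kappa : R) (A : set (signseq R))
    (good : set (seq bool)) (P : seq bool -> R) :
  (0 <= s)%R -> (0 < kappa)%R -> (forall u, 0 <= P u)%R ->
  (forall u, P (rcons u false) + P (rcons u true) <= P u)%R ->
  (forall u, good u -> expR (- (s * ln 2 * (size u)%:R)) <=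
     P u * expR (- (kappa * (size u)%:R)))%R ->
  (forall x M, A x -> exists2 N, (M <= N)%N & good (mkseq x N)) ->
  hausdorff_measure s A = 0.
Proof.
move=> s0 k0 P0 PD Pgood Agood; apply/eqP; rewrite eq_le; apply/andP; split; last first.
  apply: (@le_trans _ _ (hausdorff_premeasure s 1 A)); last first.
    by apply: ereal_sup_ubound; exists 1%R; [exact: ltr01|].
  apply: le_ereal_inf_tmp => _ [U _ <-].
  by apply: nneseries_ge0 => i _ _; exact: diam_pow_ge0.
apply: ge_ereal_sup => _ [delta /= d0 <-].
apply/lee_addgt0Pr => e e0; rewrite add0e.
pose t := expR (- (kappa / 2)).
have t01 : (0 < t < 1)%R by rewrite expR_gt0 expR_lt1 oppr_lt0 divr_gt0.
have [M1 hM1] := @expR_eventually_small R (P [::] / (1 - t)) (kappa / 2) e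
  (divr_gt0 k0 (ltr0n _ 2)) e0.
have [M2 hM2] := @expR_eventually_small R 1 (ln 2) delta (ln2_gt0 R) d0.
pose M := maxn M1 M2.
pose ok (w : seq bool) := `[< good w >] && (M <= size w)%N.
(* Words are enumerated by their codes; all other indices get the empty set, whose cost is 0. *)
pose U i : set (signseq R) :=
  if pickle_inv i is Some w then (if ok w then cylinder R w else set0) else set0.
have Ucov : delta_cover delta A U.
  split=> [x Ax|i].
    have [N MN gN] := Agood x M Ax.
    exists (pickle (mkseq x N)) => //; rewrite /U pickleK_inv /ok size_mkseq MN.
    by rewrite andbT; case: asboolP => // _; rewrite /cylinder /= size_mkseq.
  have set0d : diam (@set0 (signseq R)) <= delta%:E.
    by apply: ge_ereal_sup => _ [[? ?] [[]]].
  rewrite /U; case: pickle_inv => // w; case: ifP => // /andP[_ Mw].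
  apply: le_trans (diam_cylinder _ _) _; rewrite lee_fin two_expR ltW//.
  rewrite -[ltLHS]mul1r [(_ * ln 2)%R]mulrC hM2//.
  exact: leq_trans (leq_maxr _ _) Mw.
apply: (@le_trans _ _ (\sum_(0 <= i <oo) diam_pow s (U i))).
  by apply: ereal_inf_lbound; exists U.
apply: lime_le.
  by apply: is_cvg_nneseries => i _ _; exact: diam_pow_ge0.
apply: nearW => k.
pose F (w : seq bool) : R := (P w * t ^+ size w * t ^+ M)%R.
have F0 w : (0 <= F w)%R by rewrite !mulr_ge0 ?exprn_ge0 ?expR_ge0.
have UF i : diam_pow s (U i) <= (oapp F 0 (pickle_inv i))%:E.
  have set0F : diam_pow s (@set0 (signseq R)) = 0 by rewrite /diam_pow eqxx.
  rewrite /U; case: pickle_inv => [w|] /=; last by rewrite set0F.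
  case: ifP => [/andP[/asboolP gw Mw]|_]; last by rewrite set0F lee_fin.
  apply: le_trans (diam_pow_cylinder _ _ _ s0) _; rewrite lee_fin.
  apply: le_trans (Pgood _ gw) _; rewrite /F -mulrA ler_wpM2l//.
  rewrite /t -!expRM_natl -expRD ler_expR.
  have : (M%:R <= (size w)%:R :> R)%R by rewrite ler_nat.
  move=> h; have := ler_wpM2l (ltW k0) h; lra.
apply: (@le_trans _ _ (\sum_(0 <= i < k) (oapp F 0 (pickle_inv i))%:E)).
  by apply: lee_sum => i _; exact: UF.
(* The words decoded from the indices below [k] are distinct, so [geometric_word_sum] bounds every
   partial sum. *)
rewrite sumEFin lee_fin -big_pmap -mulr_suml.
have := geometric_word_sum _ _ _ _ P0 PD t01
  (pmap_uniq (@pickle_invK (seq bool)) (iota_uniq 0 k)).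
rewrite /index_iota subn0 => hsum.
apply: le_trans (ler_wpM2r _ hsum) _; first by rewrite exprn_ge0 ?expR_ge0.
rewrite ltW// /t -expRM_natl mulrN [(M%:R * _)%R]mulrC.
by apply: hM1; rewrite leq_maxl.
Qed.

(** A mass distribution principle: a cheap cover would lie in cylinders of total mass below [P
    [::]], and a branch avoiding them would be a point of [A] outside the cover. *)
Lemma hausdorff_measure_neq0 (R : realType) (s sigma C : R)
    (A : set (signseq R)) (P : seq bool -> R) :
  (0 <= s)%R -> (0 < sigma)%R -> (s * ln 2 <= sigma)%R ->
  (forall u, 0 <= P u)%R ->
  (forall u, P u <= P (rcons u false) + P (rcons u true))%R ->
  (0 < P [::])%R ->
  (forall u, P u <= C * expR (- (sigma * (size u)%:R)))%R ->
  (forall x : signseq R, (forall N, 0 < P (mkseq x N))%R -> A x) ->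
  hausdorff_measure s A <> 0.
Proof.
move=> s0 sig0 ssig P0 PD Pnil PC PA HA.
have C0 : (0 < C)%R.
  by have := PC [::]; rewrite /= mulr0 oppr0 expR0 mulr1; exact: lt_le_trans.
(* The exponential makes up for the extra 1 in [N.+1] in [diam_pow_ge]. *)
pose D := (C * expR (s * ln 2))%R.
have D0 : (0 < D)%R by rewrite mulr_gt0 ?expR_gt0.
have : hausdorff_premeasure s 1 A < (P [::] / 2 / D)%:E.
  apply: (@le_lt_trans _ _ 0); last by rewrite lte_fin !divr_gt0.
  by rewrite -HA; apply: ereal_sup_ubound; exists 1%R; [exact: ltr01|].
move=> /ereal_inf_lt[_ [U [AU _] <-] hU].
(* The cover costs at most [P [::] / 2] and the errors sum to at most [P [::] / 4], which leaves
   room below [P [::]]. *)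
pose e := (P [::] / 4)%R; have e0 : (0 < e)%R by rewrite divr_gt0.
(* The word is the longest common prefix of [U i]. If [U i] has at most one point, it is taken so
   long that its mass is below the error term. *)
have hw i : exists w : seq bool, (forall y, U i y -> cylinder R w y) /\
    (P w)%:E <= D%:E * diam_pow s (U i) + (e / (2 ^ i.+1)%:R)%:E.
  have ei0 : (0 < e / (2 ^ i.+1)%:R :> R)%R by rewrite divr_gt0// ltr0n expn_gt0.
  have [N0 hN0] := @expR_eventually_small R C sigma _ sig0 ei0.
  have tiny w : (N0 <= size w)%N ->
      (P w)%:E <= D%:E * diam_pow s (U i) + (e / (2 ^ i.+1)%:R)%:E.
    move=> Nw; apply: le_trans (_ : (e / (2 ^ i.+1)%:R)%:E <= _).
      by rewrite lee_fin (le_trans (PC _))// ltW// hN0.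
    by rewrite leeDr// mule_ge0 ?diam_pow_ge0// lee_fin ltW.
  have [[x Ux]|Ui0] := pselect (U i !=set0); last first.
    exists (nseq N0 false); split; last by apply: tiny; rewrite size_nseq.
    by move=> y Uy; exfalso; apply: Ui0; exists y.
  pose dif := [pred j : nat | `[< exists2 y, U i y & y j <> x j >]].
  have [ex|nex] := pselect (exists j, dif j); last first.
    exists (mkseq x N0); split; last by apply: tiny; rewrite size_mkseq.
    move=> y Uy; rewrite /cylinder /= size_mkseq; apply: eq_mkseq => j.
    apply: contrapT => yx; apply: nex; exists j.
    by apply/asboolP; exists y.
  have [N /asboolP[y Uy yx] minN] := ex_minnP ex.
  exists (mkseq x N); split=> [z Uz|].
    rewrite /cylinder /= size_mkseq.
    apply: (@eq_from_nth _ false) => [|j]; rewrite !size_mkseq // => jN.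
    rewrite !nth_mkseq//; apply: contrapT => zx.
    by have : (N <= j)%N; [apply: minN; apply/asboolP; exists z | rewrite leqNgt jN].
  apply: (@le_trans _ _ (D%:E * diam_pow s (U i))); last first.
    by rewrite leeDl// lee_fin ltW.
  apply: (@le_trans _ _ (D%:E * (expR (- (s * ln 2 * N.+1%:R)))%:E)); last first.
    by rewrite lee_pmul2l ?lte_fin//; exact: diam_pow_ge s0 Uy Ux yx.
  rewrite -EFinM lee_fin; apply: le_trans (PC _) _; rewrite size_mkseq /D -[leRHS]mulrA.
  rewrite ler_wpM2l ?(ltW C0)// -expRD ler_expR -natr1.
  have := ler_wpM2r (ler0n R N) ssig; lra.
have [w hwP] := choice hw.
have [|x xP] := @avoiding_branch R P w P0 PD.
  apply: (@le_lt_trans _ _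
    (\sum_(0 <= i <oo) (D%:E * diam_pow s (U i) + (e / (2 ^ i.+1)%:R)%:E))).
    apply: lee_nneseries => [i _ _|i _]; first by rewrite lee_fin.
    by have [] := hwP i.
  apply: le_lt_trans (epsilon_trick xpredT _ (ltW e0)) _ => [i|].
    by rewrite mule_ge0 ?diam_pow_ge0// lee_fin ltW.
  rewrite nneseriesZl => [|i _]; last exact: diam_pow_ge0.
  apply: (@le_lt_trans _ _ (D%:E * (P [::] / 2 / D)%:E + e%:E)).
    by rewrite leeD2r// lee_pmul2l ?lte_fin// ltW.
  by rewrite -EFinM -EFinD lte_fin mulrC divfK ?gt_eqF// /e; lra.
have [i _ Ux] := AU x (PA x (fun N => (xP N).1)).
have [hcyl _] := hwP i.
by have [_ /(_ i) []] := xP (size (w i)); rewrite hcyl.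
Qed.

End ereal.

(** * The dimension of the level set *)

Lemma entropyE (R : realType) (t : R) : entropy t * ln 2 = nat_entropy t.
Proof.
have l0 := ln2_gt0 R; rewrite /entropy /log2 /nat_entropy; field.
by rewrite gt_eqF.
Qed.

Lemma nat_entropy_ge0 (R : realType) (p : R) : 0 <= p <= 1 -> 0 <= nat_entropy p.
Proof.
move=> /andP[p0 p1]; have q0 : 0 <= 1 - p by rewrite subr_ge0.
rewrite /nat_entropy oppr_ge0 -[leRHS]addr0 lerD// mulr_ge0_le0 ?ln_le0//.
by rewrite gerBl.
Qed.

Lemma plus_deviation_mkseq (R : realType) (l : nat) (theta : R)
    (x : signseq R) (n : nat) : (0 < l)%N -> (0 < n)%N ->
  plus_deviation l ((1 + theta) / 2) (mkseq x (l * n)) =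
  n%:R / 2 * (multiple_average l x n - theta).
Proof.
move=> l0 n0; rewrite /plus_deviation size_mkseq mulKn// multiple_averageE.
rewrite (@eq_plus_count _ _ x) => [|i il]; last by rewrite nth_mkseq.
by field; rewrite pnatr_eq0 -lt0n.
Qed.

(** At length [l * n] the deviation is [n / 2] times the error of the average, so a bounded
    deviation makes that error O(1/n). *)
Lemma level_set_of_deviation (R : realType) (l : nat) (theta A : R)
    (x : signseq R) : (0 < l)%N ->
  (forall N, plus_deviation l ((1 + theta) / 2) (mkseq x N) ^+ 2 <= A) ->
  level_set l theta x.
Proof.
move=> l0 hA; rewrite /level_set /=; apply/cvgrPdist_lt => e e0.
have A0 : 0 <= A by apply: le_trans (hA 0%N); exact: sqr_ge0.
(* For [n > B], an error of at least [e] would make the deviation exceed [1 + A], whose square is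
   above [A]. *)
pose B := (1 + A) * 2 / e.
have B0 : 0 <= B by rewrite !mulr_ge0 ?invr_ge0 ?(ltW e0)// addr_ge0.
exists (Num.Def.archi_bound B).+1 => // n /= nB.
have n0 : (0 < n)%N by apply: leq_ltn_trans nB.
have nR : 0 < n%:R :> R by rewrite ltr0n.
have Bn : B < n%:R.
  by apply: lt_le_trans (archi_boundP B0) _; rewrite ler_nat ltnW.
rewrite /B ltr_pdivrMr// in Bn.
rewrite distrC; have := hA (l * n)%N; rewrite plus_deviation_mkseq//.
rewrite -(real_normK (num_real _)) normrM (ger0_norm (_ : 0 <= n%:R / 2)) ?divr_ge0//.
set d := `|_|; have d0 : 0 <= d by rewrite normr_ge0.
move=> hd; rewrite ltNge; apply/negP => ed.
have h1 : n%:R * e <= n%:R * d by rewrite ler_wpM2l// ltW.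
have h2 : 1 + A < n%:R / 2 * d by lra.
have h3 : (1 + A) ^+ 2 < (n%:R / 2 * d) ^+ 2.
  by rewrite ltr_pXn2r// nnegrE ?addr_ge0// !mulr_ge0.
have := lt_le_trans h3 hd; nra.
Qed.

Theorem theorem1p1 (R : realType) (l : nat) (hl : (1 <= l)%N)
    (theta : R) (htheta : -1 <= theta <= 1) :
  hausdorff_dim (level_set l theta) =
  (1 - 1 / l%:R + 1 / l%:R * entropy ((1 + theta) / 2))%:E.
Proof.
set p := (1 + theta) / 2; set d := 1 - _ + _.
have p01 : 0 <= p <= 1 by rewrite /p; lra.
have l2 := ln2_gt0 R.
have lR : 0 < l%:R :> R by rewrite ltr0n.
have dE : d * ln 2 = ln 2 - (ln 2 - nat_entropy p) / l%:R.
  by rewrite -entropyE /d; field; rewrite gt_eqF.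
have d0 : 0 <= d.
  rewrite -(pmulr_lge0 _ l2) dE subr_ge0 ler_pdivrMr//.
  have := nat_entropy_ge0 _ _ p01.
  have : 1 <= l%:R :> R by rewrite ler1n.
  nra.
apply/eqP; rewrite eq_le; apply/andP; split.
  apply/lee_addgt0Pr => e e0; rewrite -EFinD; apply: ereal_inf_lbound.
  exists (d + e) => //; split; first by rewrite addr_ge0 // ltW.
  have [|P [eps [kappa [eps0 k0 P0 PD Pw]]]] :=
      @cover_weight R l p ((d + e) * ln 2) hl p01.
    by rewrite -dE ltr_pM2r// ltrDl.
  pose good (u : seq bool) := (l %| size u)%N /\
    `|plus_deviation l p u| <= eps * (size u %/ l)%:R.
  apply: (@hausdorff_measure_eq0 R _ kappa _ good P) => //.
  - by rewrite addr_ge0 // ltW.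
  - by move=> u [] ? ?; apply: Pw.
  move=> x M; rewrite /level_set /= => /cvgrPdist_lt /(_ eps eps0)[n0 _ hn].
  (* [M.+1] makes [n] positive and the word at least [M] long. *)
  pose n := maxn n0 M.+1; have n1 : (0 < n)%N by rewrite leq_max orbT.
  exists (l * n)%N.
    by apply: leq_trans (leq_pmull _ hl); rewrite leq_max leqnSn orbT.
  rewrite /good size_mkseq dvdn_mulr// mulKn//; split=> //.
  have := hn n (leq_maxl _ _); rewrite /p plus_deviation_mkseq// distrC => /ltW h.
  rewrite normrM ger0_norm ?divr_ge0// mulrC; apply: ler_pM => //.
  by rewrite ler_pdivrMr// ler_peMr// ler1n.
apply: le_ereal_inf_tmp => _ [s [s0 Hs] <-]; rewrite lee_fin leNgt.
apply/negP => sd.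
(* The midpoint of [s] and [d] stays below [d] and is positive even when [s = 0]. *)
have [|P [A [C [P0 PD Pnil PA PC]]]] :=
    @subexponential_flow R l p ((s + d) / 2 * ln 2) hl p01.
  by rewrite -dE ltr_pM2r//; lra.
apply: (@hausdorff_measure_neq0 R s ((s + d) / 2 * ln 2) C (level_set l theta) P) => //.
- by rewrite mulr_gt0//; lra.
- by rewrite ler_wpM2r ?(ltW l2)//; lra.
move=> x xP; apply: (@level_set_of_deviation _ _ _ A) => // N.
exact: PA.
Qed.
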